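(* Let $f:\mathbb{R}\to\mathbb{R}$ be differentiable. Let $\mathbb{T}$ be a given time scale with (forward) graininess function $\mu(t)$. If $f$ is delta differentiable at $t\in\mathbb{T}^\kappa$, then $$f^\Delta(t)=\int_0^1 f'(t+\tau\mu(t))\,d\tau .$$
   Context: A time scale $\mathbb{T}$ is an arbitrary nonempty closed subset of $\mathbb{R}$. The forward jump operator $\sigma:\mathbb{T}\to\mathbb{T}$ is $\sigma(t)=\inf\{s\in\mathbb{T}: s>t\}$ for $t\neq\sup\mathbb{T}$, and $\sigma(\sup\mathbb{T})=\sup\mathbb{T}$ if $\sup\mathbb{T}<+\infty$. The backward jump operator $\rho:\mathbb{T}\to\mathbb{T}$ is $\rho(t)=\sup\{s\in\mathbb{T}: s<t\}$ for $t\neq\inf\mathbb{T}$, and $\rho(\inf\mathbb{T})=\inf\mathbb{T}$ if $\inf\mathbb{T}>-\infty$. The forward graininess function is $\mu:\mathbb{T}\to[0,\infty)$, $\mu(t)=\sigma(t)-t$. A point $t\in\mathbb{T}$ is left-scattered if $\rho(t)<t$. If $\sup\mathbb{T}$ is finite and left-scattered, then $\mathbb{T}^\kappa=\mathbb{T}\setminus\{\sup\mathbb{T}\}$; otherwise $\mathbb{T}^\kappa=\mathbb{T}$. A function $f:\mathbb{T}\to\mathbb{R}$ is delta differentiable at $t\in\mathbb{T}^\kappa$ if there exists a number $f^\Delta(t)$ (called the delta derivative of $f$ at $t$) such that for every $\varepsilon>0$ there is $\delta>0$ such that for all $s\in(t-\delta,t+\delta)\cap\mathbb{T}$, $$|f(\sigma(t))-f(s)-f^\Delta(t)(\sigma(t)-s)|\le\varepsilon|\sigma(t)-s|.$$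 For $f:\mathbb{R}\to\mathbb{R}$, delta differentiability and $f^\Delta(t)$ refer to the restriction of $f$ to $\mathbb{T}$, and $f'$ denotes the ordinary derivative on $\mathbb{R}$. *)

(* Defs.v *)
From Stdlib Require Import Reals.
From Coquelicot Require Import Coquelicot.
Open Scope R_scope.

Definition time_scale (T : R -> Prop) : Prop := (exists x, T x) /\ closed T.

(* [Lub_Rbar T] and [Glb_Rbar T] are sup T and inf T in the extended reals.
   For t in a closed T with t <> sup T, the infimum in [sigma] is finite, so
   the projection [real] loses nothing; likewise for [rho]. *)
Definition sigma (T : R -> Prop) (t : R) : R :=
  if Rbar_eq_dec (Finite t) (Lub_Rbar T) then t
  else real (Glb_Rbar (fun s => T s /\ t < s)).

Definition rho (T : R -> Prop) (t : R) : R :=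
  if Rbar_eq_dec (Finite t) (Glb_Rbar T) then t
  else real (Lub_Rbar (fun s => T s /\ s < t)).

Definition mu (T : R -> Prop) (t : R) : R := sigma T t - t.

Definition left_scattered (T : R -> Prop) (t : R) : Prop := rho T t < t.

Definition kappa (T : R -> Prop) (t : R) : Prop :=
  T t /\ ~ (Lub_Rbar T = Finite t /\ left_scattered T t).

(* When T = {t}, every real D satisfies this predicate.  For every other time
   scale and every t in T^kappa there is at most one such D. *)
Definition is_delta_derivative (T : R -> Prop) (f : R -> R) (t D : R) : Prop :=
  forall eps : R, 0 < eps ->
  exists delta : R, 0 < delta /\
  forall s : R, T s -> t - delta < s < t + delta ->
    Rabs (f (sigma T t) - f s - D * (sigma T t - s))
      <= eps * Rabs (sigma T t - s).

Definition delta_differentiable (T : R -> Prop) (f : R -> R) (t : R) : Prop :=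
  exists D : R, is_delta_derivative T f t D.

(* An everywhere existing derivative need be neither Riemann nor Lebesgue
   integrable (x^2 sin(1/x^2) near 0), so its integral over an interval is
   taken here in the sense of Henstock and Kurzweil.  That integral extends
   both of the others, with the same values.  [is_HKInt] is Coquelicot's
   [is_RInt] with the uniform mesh bound of [Riemann_fine] replaced by a
   gauge, that is, a bound depending on the tag [y_i] of each cell
   [x_i, x_(i+1)]. *)
Definition HK_fine (a b : R) (P : @SF_seq R -> Prop) : Prop :=
  exists gauge : R -> posreal,
  forall ptd : @SF_seq R,
    pointed_subdiv ptd ->
    SF_h ptd = Rmin a b ->
    seq.last (SF_h ptd) (SF_lx ptd) = Rmax a b ->
    (forall i : nat, (i < SF_size ptd)%nat ->
       let y := seq.nth 0 (SF_ly ptd) i in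
       y - gauge y < seq.nth 0 (SF_lx ptd) i /\
       seq.nth 0 (SF_lx ptd) (S i) < y + gauge y) ->
    P ptd.

Definition is_HKInt (g : R -> R) (a b I : R) : Prop :=
  filterlim (fun ptd => scal (sign (b - a)) (Riemann_sum g ptd))
    (HK_fine a b) (locally I).

Definition ex_HKInt (g : R -> R) (a b : R) : Prop :=
  exists I : R, is_HKInt g a b I.

Definition HKInt (g : R -> R) (a b : R) : R := iota (is_HKInt g a b).

(* Main.v *)
Require Import Defs.
From Stdlib Require Import Reals Lra Lia Classical IndefiniteDescription.
From Coquelicot Require Import Coquelicot.
Open Scope R_scope.

(** The gauge integral integrates every derivative: if the gauge at [y] is
    taken from the definition of [F'(y)] with tolerance [eps], then
    [F(v) - F(u)] differs from [F'(y) (v - u)] by at most [eps (v - u)] on each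
    fine cell [[u, v]] tagged at [y], and these errors add up to at most
    [eps (b - a)].  Cousin's lemma makes the value of the integral unique.
    Applied to [F(tau) = f(t + tau mu) / mu] when [mu <> 0], and to
    [F(tau) = f'(t) tau] when [mu = 0], this evaluates the integral to
    [(f(sigma t) - f(t)) / mu], respectively [f'(t)].  The first is the delta
    derivative by taking [s = t] in its definition, the second because [t] is
    then an accumulation point of the time scale (or its only point). *)

(** * Tagged subdivisions and Cousin's lemma *)

Lemma Forall_lt_size_cons (P : nat -> Prop) (h : R * R) (p : @SF_seq R) :
  (forall i, (i < SF_size (SF_cons h p))%nat -> P i) <->
  P 0%nat /\ forall i, (i < SF_size p)%nat -> P (S i).
Proof.
  rewrite SF_size_cons; split.
  - intros H; split; [|intros i Hi]; apply H; lia.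
  - intros [H0 H] [|i] Hi; [exact H0|apply H; lia].
Qed.

Lemma pointed_subdiv_cons (x y : R) (p : @SF_seq R) :
  pointed_subdiv (SF_cons (x, y) p) <->
  x <= y <= SF_h p /\ pointed_subdiv p.
Proof. apply Forall_lt_size_cons. Qed.

(** The premise of [HK_fine], named so that inductions can split off the first cell. *)
Definition gauge_fine (gauge : R -> posreal) (p : @SF_seq R) : Prop :=
  forall i : nat, (i < SF_size p)%nat ->
    let y := seq.nth 0 (SF_ly p) i in
    y - gauge y < seq.nth 0 (SF_lx p) i /\
    seq.nth 0 (SF_lx p) (S i) < y + gauge y.

Lemma gauge_fine_cons (gauge : R -> posreal) (x y : R) (p : @SF_seq R) :
  gauge_fine gauge (SF_cons (x, y) p) <->
  (y - gauge y < x /\ SF_h p < y + gauge y) /\ gauge_fine gauge p.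
Proof. apply Forall_lt_size_cons. Qed.

Lemma SF_last_cons (h : R * R) (p : @SF_seq R) :
  seq.last (SF_h (SF_cons h p)) (SF_lx (SF_cons h p)) =
  seq.last (SF_h p) (SF_lx p).
Proof. reflexivity. Qed.

Lemma pointed_subdiv_le (p : @SF_seq R) :
  pointed_subdiv p -> SF_h p <= seq.last (SF_h p) (SF_lx p).
Proof.
  induction p as [x|[x y] p IH] using SF_cons_ind; [intros _; apply Rle_refl|].
  rewrite pointed_subdiv_cons, SF_last_cons; intros [Hxy Hp].
  specialize (IH Hp); simpl in *; lra.
Qed.

(** Subdivisions grow at the left end, so consider the points of [[a, b]] from which a fine
    subdivision reaches [b]. Their infimum is such a point, since a cell tagged there catches one of
    them; were it above [a], the same tag would allow a cell further left. *)
Lemma cousin (gauge : R -> posreal) (a b : R) : a <= b ->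
  exists p : @SF_seq R, pointed_subdiv p /\ SF_h p = a /\
    seq.last (SF_h p) (SF_lx p) = b /\ gauge_fine gauge p.
Proof.
  intros Hab.
  set (E := fun x : R => exists p : @SF_seq R, pointed_subdiv p /\ SF_h p = x /\
    seq.last (SF_h p) (SF_lx p) = b /\ gauge_fine gauge p).
  assert (Eb : E b).
  { exists (SF_nil b); split; [|split; [|split]]; try reflexivity;
      intros i Hi; inversion Hi. }
  assert (Econs : forall x y z, E z -> x <= y <= z -> y - gauge y < x ->
                    z < y + gauge y -> E x).
  { intros x y z (p & Hp & Hz & Hl & Hg) Hxyz H1 H2; subst z.
    exists (SF_cons (x, y) p).
    rewrite pointed_subdiv_cons, gauge_fine_cons, SF_last_cons.
    tauto. }
  (* [completeness] yields suprema, so the set is reflected: [- m] is the infimum. *)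
  destruct (completeness (fun x => a <= - x /\ E (- x))) as [m [Hub Hlub]].
  { exists (- a); intros x [Hx _]; lra. }
  { exists (- b); rewrite Ropp_involutive; tauto. }
  assert (Ham : m <= - a) by (apply Hlub; intros x [Hx _]; lra).
  pose proof (cond_pos (gauge (- m))) as Hpos.
  assert (Em : E (- m)).
  { destruct (classic (exists x, (a <= - x /\ E (- x)) /\ m - gauge (- m) < x))
      as [[x [Hx Hmx]]|Hno].
    - pose proof (Hub x Hx); apply (Econs (- m) (- m) (- x)); try tauto; lra.
    - enough (m <= m - gauge (- m)) by lra.
      apply Hlub; intros x Hx.
      apply Rnot_lt_le; intros Hlt; apply Hno; exists x; tauto. }
  destruct Ham as [Ham|Ham]; [|subst m; rewrite Ropp_involutive in Em; exact Em].
  (* The cell from [y] to [- m], tagged at its right end, stays inside the gauge and does not pass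
     [a]. *)
  set (y := Rmax a (- m - gauge (- m) / 2)).
  assert (Hy : a <= y /\ - m - gauge (- m) < y /\ y < - m)
    by (unfold y, Rmax; destruct Rle_dec; lra).
  enough (- y <= m) by lra.
  apply Hub; rewrite Ropp_involutive; split; [tauto|].
  apply (Econs y (- m) (- m)); try tauto; lra.
Qed.

(** * Uniqueness of the gauge integral and comparison with Riemann *)

Global Instance HK_fine_proper_filter (a b : R) : ProperFilter' (HK_fine a b).
Proof.
  split; [|split].
  - intros [gauge H].
    (* Properness is Cousin's lemma: every gauge admits a fine subdivision. *)
    destruct (cousin gauge (Rmin a b) (Rmax a b)) as (p & Hp & Hh & Hl & Hg).
    { apply Rmin_Rmax. }
    exact (H p Hp Hh Hl Hg).
  - exists (fun _ => mkposreal 1 Rlt_0_1); trivial.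
  - intros P Q [g1 H1] [g2 H2].
    exists (fun y => mkposreal _ (Rmin_stable_in_posreal (g1 y) (g2 y))).
    intros p Hp Hh Hl Hg; split; [apply H1|apply H2]; trivial;
      intros i Hi; destruct (Hg i Hi) as [Hl1 Hr1]; simpl in Hl1, Hr1;
      [pose proof (Rmin_l (g1 (seq.nth 0 (SF_ly p) i)) (g2 (seq.nth 0 (SF_ly p) i)))
      |pose proof (Rmin_r (g1 (seq.nth 0 (SF_ly p) i)) (g2 (seq.nth 0 (SF_ly p) i)))];
      simpl; lra.
  - intros P Q HPQ [gauge H]; exists gauge; auto.
Qed.

Lemma is_HKInt_unique (g : R -> R) (a b I J : R) :
  is_HKInt g a b I -> is_HKInt g a b J -> I = J.
Proof.
  apply (@filterlim_locally_unique _ _ R_NormedModule _ (HK_fine_proper_filter a b)).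
Qed.

Lemma HKInt_unique (g : R -> R) (a b I : R) :
  is_HKInt g a b I -> HKInt g a b = I.
Proof.
  intros H; apply (@iota_unique _ R_CompleteNormedModule); [|exact H].
  intros J HJ; exact (is_HKInt_unique g a b J I HJ H).
Qed.

(** Each cell extends less than [d / 2] to either side of its tag, so a mesh bound is a special
    gauge. *)
Lemma gauge_fine_seq_step (d : posreal) (p : @SF_seq R) :
  pointed_subdiv p -> gauge_fine (fun _ => pos_div_2 d) p ->
  seq_step (SF_lx p) < d.
Proof.
  pose proof (cond_pos d).
  induction p as [x|[x y] p IH] using SF_cons_ind; [intros _ _; exact H|].
  rewrite pointed_subdiv_cons, gauge_fine_cons; simpl.
  intros [Hxy Hp] [Hd Hg].
  apply Rmax_lub_lt; [|exact (IH Hp Hg)].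
  rewrite Rabs_pos_eq; simpl in *; lra.
Qed.

Lemma is_RInt_is_HKInt (g : R -> R) (a b I : R) :
  is_RInt g a b I -> is_HKInt g a b I.
Proof.
  intros H P HP; destruct (H P HP) as [d Hd].
  exists (fun _ => pos_div_2 d); intros p Hp Hh Hl Hg.
  apply Hd; [|tauto].
  apply gauge_fine_seq_step; assumption.
Qed.

(** * Integrals of derivatives *)

Lemma Riemann_sum_straddle (F g : R -> R) (gauge : R -> posreal)
    (eps a b : R) (p : @SF_seq R) :
  (forall x y, a <= y <= b -> Rabs (x - y) < gauge y ->
     Rabs (F x - F y - g y * (x - y)) <= eps * Rabs (x - y)) ->
  pointed_subdiv p -> gauge_fine gauge p ->
  a <= SF_h p -> seq.last (SF_h p) (SF_lx p) = b ->
  Rabs (Riemann_sum g p - (F b - F (SF_h p))) <= eps * (b - SF_h p).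
Proof.
  intros HF.
  induction p as [x|[x y] p IH] using SF_cons_ind.
  - intros _ _ _ <-; unfold Riemann_sum; simpl; unfold zero; simpl.
    rewrite !Rminus_diag, Rabs_R0; lra.
  - rewrite pointed_subdiv_cons, gauge_fine_cons, SF_last_cons.
    intros [Hxy Hp] [Hd Hg] Ha Hl.
    pose proof (pointed_subdiv_le p Hp) as Hle; rewrite Hl in Hle.
    rewrite Riemann_sum_cons; simpl in *.
    change (plus ?u ?v) with (u + v); change (scal ?u ?v) with (u * v).
    assert (Hy : a <= y <= b) by lra.
    assert (Ha' : a <= SF_h p) by lra.
    specialize (IH Hp Hg Ha' Hl).
    (* The cell is split at its tag: the errors [eps * (y - x)] and [eps * (SF_h p - y)] add up to
       [eps] times its length. *)
    pose proof (HF x y Hy) as Hu; rewrite (Rabs_left1 (x - y)) in Hu by lra.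
    pose proof (HF (SF_h p) y Hy) as Hv.
    rewrite (Rabs_pos_eq (SF_h p - y)) in Hv by lra.
    specialize (Hu ltac:(lra)); specialize (Hv ltac:(lra)).
    apply Rabs_le_between in IH, Hu, Hv; apply Rabs_le_between; lra.
Qed.

Lemma is_HKInt_derive (F g : R -> R) (a b : R) :
  (forall x, Rmin a b <= x <= Rmax a b -> is_derive F x (g x)) ->
  is_HKInt g a b (F b - F a).
Proof.
  intros HF.
  assert (Hgauge : forall eps : posreal, exists gauge : R -> posreal,
    forall y, Rmin a b <= y <= Rmax a b ->
    forall x, Rabs (x - y) < gauge y ->
      Rabs (F x - F y - g y * (x - y)) <= eps * Rabs (x - y)).
  (* Choice assembles the radii into a gauge; outside the interval any radius will do. *)
  { intros eps; apply (functional_choice (fun y (d : posreal) =>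
      Rmin a b <= y <= Rmax a b -> forall x, Rabs (x - y) < d ->
      Rabs (F x - F y - g y * (x - y)) <= eps * Rabs (x - y))); intros y.
    destruct (classic (Rmin a b <= y <= Rmax a b)) as [Hy|Hy].
    - destruct (proj2 (HF y Hy) y (fun P HP => HP) eps) as [d Hd].
      exists d; intros _ x Hx; rewrite (Rmult_comm (g y)); exact (Hd x Hx).
    - exists eps; tauto. }
  apply filterlim_locally; intros eps.
  pose proof (Rmin_Rmax a b) as Hab.
  (* Adding 1 keeps the denominator positive when [a = b] and makes the final bound strict. *)
  assert (Heps : 0 < eps / (Rmax a b - Rmin a b + 1))
    by (apply Rdiv_lt_0_compat; [apply cond_pos|lra]).
  set (e := mkposreal _ Heps).
  destruct (Hgauge e) as [gauge Hg]; exists gauge; intros p Hp Hh Hl Hfine.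
  assert (HS := Riemann_sum_straddle F g gauge e (Rmin a b) (Rmax a b) p
    (fun x y Hy => Hg y Hy x) Hp Hfine (Req_le _ _ (eq_sym Hh)) Hl).
  rewrite Hh in HS.
  assert (He : e * (Rmax a b - Rmin a b) < eps).
  { replace (pos eps) with (e * (Rmax a b - Rmin a b + 1))
      by (simpl; field; lra).
    apply Rmult_lt_compat_l; [apply cond_pos|lra]. }
  change (Rabs (sign (b - a) * Riemann_sum g p - (F b - F a)) < eps).
  apply Rabs_le_between in HS; apply Rabs_lt_between.
  destruct (Rtotal_order a b) as [Hlt|[->|Hlt]].
  - rewrite Rmin_left, Rmax_right in * by lra.
    rewrite sign_eq_1 by lra; lra.
  - rewrite Rminus_diag, sign_0; pose proof (cond_pos eps); lra.
  - rewrite Rmin_right, Rmax_left in * by lra.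
    rewrite sign_eq_m1 by lra; lra.
Qed.

(** * Accumulation points of the time scale *)

Lemma is_lub_Rbar_gt (E : R -> Prop) (l : Rbar) (x : R) :
  is_lub_Rbar E l -> Rbar_lt x l -> exists s, E s /\ x < s.
Proof.
  intros [_ Hl] Hx; apply NNPP; intros Hno.
  apply (Rbar_lt_not_le _ _ Hx), Hl; intros s Hs.
  apply Rnot_lt_le; intros Hlt; apply Hno; exists s; tauto.
Qed.

Lemma is_glb_Rbar_lt (E : R -> Prop) (l : Rbar) (x : R) :
  is_glb_Rbar E l -> Rbar_lt l x -> exists s, E s /\ s < x.
Proof.
  intros [_ Hl] Hx; apply NNPP; intros Hno.
  apply (Rbar_lt_not_le _ _ Hx), Hl; intros s Hs.
  apply Rnot_lt_le; intros Hlt; apply Hno; exists s; tauto.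
Qed.

Lemma sigma_eq_right_dense (T : R -> Prop) (t delta : R) :
  T t -> Finite t <> Lub_Rbar T -> Defs.sigma T t = t -> 0 < delta ->
  exists s, T s /\ t < s < t + delta.
Proof.
  intros Ht Hsup Hsigma Hdelta; unfold Defs.sigma in Hsigma.
  destruct Rbar_eq_dec as [|_]; [contradiction|].
  assert (Hlt : Rbar_lt t (Lub_Rbar T)).
  { destruct (Rbar_le_lt_or_eq_dec t (Lub_Rbar T)) as [H|H]; [|exact H|congruence].
    apply Lub_Rbar_correct, Ht. }
  destruct (is_lub_Rbar_gt _ _ _ (Lub_Rbar_correct T) Hlt) as [u [Hu Htu]].
  pose proof (Glb_Rbar_correct (fun s => T s /\ t < s)) as HG.
  destruct (is_glb_Rbar_lt _ _ (t + delta) HG) as [s Hs].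
  (* [real] sends both infinities to 0, so [Hsigma] settles only the finite case; [u] excludes
     [p_infty], and [m_infty] is trivially below the bound. *)
  - destruct (Glb_Rbar _); simpl in *; try lra; try easy.
    apply (proj1 HG u); tauto.
  - exists s; tauto.
Qed.

Lemma rho_ge_left_dense (T : R -> Prop) (t delta : R) :
  T t -> Finite t <> Glb_Rbar T -> t <= rho T t -> 0 < delta ->
  exists s, T s /\ t - delta < s < t.
Proof.
  intros Ht Hinf Hrho Hdelta; unfold rho in Hrho.
  destruct Rbar_eq_dec as [|_]; [contradiction|].
  assert (Hlt : Rbar_lt (Glb_Rbar T) t).
  { destruct (Rbar_le_lt_or_eq_dec (Glb_Rbar T) t) as [H|H]; [|exact H|congruence].
    apply Glb_Rbar_correct, Ht. }
  destruct (is_glb_Rbar_lt _ _ _ (Glb_Rbar_correct T) Hlt) as [u [Hu Htu]].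
  pose proof (Lub_Rbar_correct (fun s => T s /\ s < t)) as HL.
  destruct (is_lub_Rbar_gt _ _ (t - delta) HL) as [s Hs].
  - destruct (Lub_Rbar _); simpl in *; try lra; try easy.
    apply (proj1 HL u); tauto.
  - exists s; tauto.
Qed.

(** Below the supremum, points accumulate from the right. At the supremum [sigma] fixes [t] by
    convention only; there [kappa] excludes left-scatteredness, so points accumulate from the
    left. *)
Lemma right_dense_accumulation (T : R -> Prop) (t delta : R) :
  kappa T t -> Defs.sigma T t = t -> (exists s, T s /\ s <> t) -> 0 < delta ->
  exists s, T s /\ s <> t /\ t - delta < s < t + delta.
Proof.
  intros [Ht Hmax] Hsigma [u [Hu Hut]] Hdelta.
  destruct (Rbar_eq_dec t (Lub_Rbar T)) as [Hsup|Hsup].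
  - destruct (rho_ge_left_dense T t delta) as [s Hs]; trivial.
    (* Were [t] both supremum and infimum, [u] would equal [t]. *)
    + intros Hinf; apply Hut, Rle_antisym.
      * pose proof (proj1 (Lub_Rbar_correct T) u Hu) as H.
        rewrite <- Hsup in H; exact H.
      * pose proof (proj1 (Glb_Rbar_correct T) u Hu) as H.
        rewrite <- Hinf in H; exact H.
    + apply Rnot_lt_le; intros Hlt; apply Hmax; split; auto.
    + exists s; repeat split; try tauto; lra.
  - destruct (sigma_eq_right_dense T t delta) as [s Hs]; trivial.
    exists s; repeat split; try tauto; lra.
Qed.

(** * Values of the delta derivative *)

Lemma Rabs_le_eps_mult (x c : R) :
  (forall eps, 0 < eps -> Rabs x <= eps * c) -> x = 0.
Proof.
  intros H.
  assert (Hc : 0 <= c) by (pose proof (H 1 Rlt_0_1); pose proof (Rabs_pos x); lra).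
  apply NNPP; intros Hx; apply Rabs_pos_lt in Hx.
  (* With this tolerance the bound is strictly below [Rabs x], even if [c = 0]. *)
  assert (Hpos : 0 < Rabs x / (c + 1)) by (apply Rdiv_lt_0_compat; lra).
  specialize (H _ Hpos).
  assert (Rabs x / (c + 1) * (c + 1) = Rabs x) by (field; lra).
  lra.
Qed.

Lemma is_delta_derivative_right_scattered (T : R -> Prop) (f : R -> R) (t D : R) :
  T t -> is_delta_derivative T f t D -> D * mu T t = f (Defs.sigma T t) - f t.
Proof.
  intros Ht HD; symmetry; apply Rminus_diag_uniq.
  apply (Rabs_le_eps_mult _ (Rabs (mu T t))); intros eps Heps.
  destruct (HD eps Heps) as [d [Hd H]]; apply H; [exact Ht|lra].
Qed.

Lemma is_delta_derivative_right_dense (T : R -> Prop) (f : R -> R) (t D l : R) :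
  kappa T t -> Defs.sigma T t = t -> (exists s, T s /\ s <> t) ->
  is_derive f t l -> is_delta_derivative T f t D -> D = l.
Proof.
  intros Ht Hsigma Hex [_ Hf] HD; apply Rminus_diag_uniq.
  (* The factor 2 counts the two linear approximations, ordinary and delta, compared at one nearby
     [s] other than [t]. *)
  apply (Rabs_le_eps_mult _ 2); intros eps Heps.
  destruct (HD eps Heps) as [d1 [Hd1 H1]].
  destruct (Hf t (fun P HP => HP) (mkposreal eps Heps)) as [d2 H2].
  destruct (right_dense_accumulation T t (Rmin d1 d2) Ht Hsigma Hex)
    as (s & Hs & Hst & Hclose).
  { apply Rmin_pos; [exact Hd1|apply cond_pos]. }
  pose proof (Rmin_l d1 d2); pose proof (Rmin_r d1 d2).
  specialize (H1 s Hs ltac:(lra)); rewrite Hsigma in H1.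
  assert (H2' : Rabs (f s - f t - (s - t) * l) <= eps * Rabs (s - t)).
  { apply (H2 s); change (Rabs (s - t) < d2); apply Rabs_lt_between; lra. }
  rewrite (Rabs_minus_sym t s) in H1.
  assert (Hpos : 0 < Rabs (s - t)) by (apply Rabs_pos_lt; lra).
  apply (Rmult_le_reg_r _ _ _ Hpos); rewrite <- Rabs_mult.
  replace ((D - l) * (s - t))
    with ((f t - f s - D * (t - s)) + (f s - f t - (s - t) * l)) by ring.
  eapply Rle_trans; [apply Rabs_triang|lra].
Qed.

Theorem theorem4p1 (f : R -> R) (hf : forall x : R, ex_derive f x)
    (T : R -> Prop) (hT : time_scale T) (t : R) (ht : kappa T t)
    (hft : delta_differentiable T f t) :
  let g := fun tau : R => Derive f (t + tau * mu T t) in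
  ex_HKInt g 0 1 /\
  is_delta_derivative T f t (HKInt g 0 1) /\
  ((exists s : R, T s /\ s <> t) ->
     forall D : R, is_delta_derivative T f t D -> D = HKInt g 0 1) /\
  (ex_RInt g 0 1 -> HKInt g 0 1 = RInt g 0 1).
Proof.
  intros g.
  assert (HI : exists I, is_HKInt g 0 1 I /\
    ((exists s : R, T s /\ s <> t) ->
       forall D : R, is_delta_derivative T f t D -> D = I)).
  { destruct (Req_dec (mu T t) 0) as [Hmu|Hmu].
    (* The witnesses stay in the form [F 1 - F 0] to match [is_HKInt_derive]. *)
    - exists (Derive f t * 1 - Derive f t * 0); split.
      + apply (is_HKInt_derive (fun x => Derive f t * x)); intros x _.
        unfold g; rewrite Hmu, Rmult_0_r, Rplus_0_r.
        auto_derive; [trivial|ring].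
      + intros Hex D HD.
        rewrite (is_delta_derivative_right_dense T f t D (Derive f t)); trivial.
        * ring.
        * apply Rminus_diag_uniq, Hmu.
        * apply Derive_correct, hf.
    - exists (f (t + 1 * mu T t) / mu T t - f (t + 0 * mu T t) / mu T t); split.
      + apply (is_HKInt_derive (fun x => f (t + x * mu T t) / mu T t)).
        intros x _; unfold g.
        auto_derive; [apply hf|field_simplify; trivial].
      + intros _ D HD.
        apply (Rmult_eq_reg_r (mu T t)); [|exact Hmu].
        rewrite (is_delta_derivative_right_scattered T f t D (proj1 ht) HD).
        replace (t + 1 * mu T t) with (Defs.sigma T t) by (unfold mu; ring).
        rewrite Rmult_0_l, Rplus_0_r; field; exact Hmu. }
  destruct HI as (I & HI & Huniq); rewrite (HKInt_unique _ _ _ _ HI).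
  split; [exists I; exact HI|split; [|split; [exact Huniq|]]].
  - destruct (classic (exists s : R, T s /\ s <> t)) as [Hex|Hno].
    + destruct hft as [D HD]; rewrite <- (Huniq Hex D HD); exact HD.
    (* On a one-point time scale the defining inequality reads [0 <= 0], so the integral qualifies
       like any other number. *)
    + assert (Hall : forall s, T s -> s = t).
      { intros s Hs; apply NNPP; intros Hst; apply Hno; exists s; tauto. }
      assert (Hsigma : Defs.sigma T t = t).
      { unfold Defs.sigma; destruct Rbar_eq_dec as [_|Hsup]; [reflexivity|].
        exfalso; apply Hsup; symmetry; apply is_lub_Rbar_unique; split.
        - intros s Hs; rewrite (Hall s Hs); apply Rbar_le_refl.
        - intros b Hb; apply Hb, ht. }
      intros eps Heps; exists 1; split; [apply Rlt_0_1|]; intros s Hs _.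
      rewrite (Hall s Hs), Hsigma, !Rminus_diag, Rmult_0_r, Rminus_diag, Rabs_R0.
      lra.
  - intros Hex; apply (is_HKInt_unique g 0 1); [exact HI|].
    apply is_RInt_is_HKInt; exact (RInt_correct g 0 1 Hex).
Qed.
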